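(* There exist positive absolute constants $\alpha, C$ with $\alpha>C$ such that the following holds. Let $n\le N$ be positive integers, let $K\subset\mathbb{R}^n$ be a symmetric and isotropic convex body, let $\theta\in S^{n-1}$, and let $X_1,\dots,X_N$ be independent random vectors uniformly distributed in $K$. Define $$h(t)=\left|K\cap\{x:\langle x,\theta\rangle=t\}\right|^{\frac1{n-1}},$$ where $|\cdot|$ here is $(n-1)$-dimensional volume. Assume that $h$ is twice differentiable and that $h'(t)\ne0$ for all $t\in(0,h_K(\theta))$. Assume also that $-h'(t)/t$ is increasing, and that $h(h_K(\theta))=0$. Then $$\mathbb{E}\max_{1\le i\le N}|\langle X_i,\theta\rangle|\ \le\ C\,h^{-1}\!\left(h(0)\left(1-\alpha\frac{\log N}{n}\right)\right).$$
   Context: A convex body in $\mathbb{R}^n$ is a compact convex set with non-empty interior; it is symmetric if $-x\in K$ whenever $x\in K$. It is isotropic if it has volume $1$, $\int_K x\,dx=0$, and there is a constant $L_K>0$ with $\int_K\langle x,\theta\rangle^2dx=L_K^2$ for all $\theta\in S^{n-1}$. $h_K(\theta)=\max\{\langle x,\theta\rangle:x\in K\}$ is the support function of $K$. $h^{-1}$ denotes the inverse function of $h$ on $[0,h_K(\theta)]$. ''Absolute constant'' means independent of $n,N,K,\theta$. *)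

(* Defs.v *)
From HB Require Import structures.
From mathcomp Require Import all_boot all_order all_algebra.
From mathcomp Require Import all_classical all_reals all_analysis.
From mathcomp Require Import ring.

Set Implicit Arguments.
Unset Strict Implicit.
Unset Printing Implicit Defensive.

Import Order.TTheory GRing.Theory Num.Theory.
Import numFieldNormedType.Exports.

Local Open Scope classical_set_scope.
Local Open Scope ring_scope.

(* The sigma-algebra on 'rV[R]_n is the product Borel sigma-algebra, generated
   by the coordinates, as the library does for n.-tuple. *)
Section measurable_row.
Context {R : realType} (n : nat).

Let coord (i : 'I_n) (x : 'rV[R]_n) : measurableTypeR R := x ord0 i.

Let row_set0 : g_sigma_preimage coord set0.
Proof. exact: sigma_algebra0. Qed.

Let row_setC A : g_sigma_preimage coord A -> g_sigma_preimage coord (~` A).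
Proof. exact: sigma_algebraC. Qed.

Let row_bigcup (F : _^nat) : (forall i, g_sigma_preimage coord (F i)) ->
  g_sigma_preimage coord (\bigcup_i (F i)).
Proof. exact: sigma_algebra_bigcup. Qed.

HB.instance Definition _ :=
  @isMeasurable.Build (measure_tuple_display default_measure_display)
    'rV[R]_n (g_sigma_preimage coord) row_set0 row_setC row_bigcup.

End measurable_row.

Section lebesgue_row.
Context {R : realType}.

Lemma measurable_row_coord n (i : 'I_n) :
  measurable_fun [set: 'rV[R]_n] (fun x => x ord0 i : measurableTypeR R).
Proof.
move=> _ Y mY; rewrite setTI; apply: sub_sigma_algebra => /=.
rewrite -bigcup_seq/=; exists i => /=; first by rewrite mem_index_enum.
by exists Y => //; rewrite setTI.
Qed.

Lemma measurable_fun_row d (T : measurableType d) n (f : T -> 'rV[R]_n) :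
  (forall i, measurable_fun [set: T] (fun x => f x ord0 i : measurableTypeR R)) ->
  measurable_fun [set: T] f.
Proof.
move=> mf; apply: (@measurability _ _ _ _ _ _
  (\big[setU/set0]_(i < n) preimage_set_system setT
     (fun x : 'rV[R]_n => x ord0 i : measurableTypeR R) measurable)) => //.
move=> _ [B + <-]; rewrite -bigcup_seq => -[i _ [C mC <-]].
by rewrite setTI; exact: mf.
Qed.

Definition cons_row n (p : measurableTypeR R * 'rV[R]_n) : 'rV[R]_n.+1 :=
  \row_i oapp (p.2 ord0) p.1 (unlift ord0 i).

Lemma cons_row0 n (p : measurableTypeR R * 'rV[R]_n) :
  cons_row p ord0 ord0 = p.1.
Proof. by rewrite mxE unlift_none. Qed.

Lemma cons_rowS n (p : measurableTypeR R * 'rV[R]_n) (i : 'I_n) :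
  cons_row p ord0 (lift ord0 i) = p.2 ord0 i.
Proof. by rewrite mxE liftK. Qed.

Lemma measurable_cons_row n : measurable_fun setT (@cons_row n).
Proof.
apply: measurable_fun_row => i; case: (unliftP ord0 i) => [j|] ->.
  under eq_fun do rewrite cons_rowS.
  exact: (measurableT_comp (@measurable_row_coord n j) measurable_snd).
under eq_fun do rewrite cons_row0.
exact: measurable_fst.
Qed.

Section step.
Local Open Scope ereal_scope.
Context n (m : {sigma_finite_measure set 'rV[R]_n -> \bar R}).

Definition lebesgue_row_step : set 'rV[R]_n.+1 -> \bar R :=
  pushforward (lebesgue_measure \x m) (@cons_row n).

Let step0 : lebesgue_row_step set0 = 0.
Proof. by rewrite /lebesgue_row_step /pushforward preimage_set0 measure0. Qed.

Let step_ge0 A : 0 <= lebesgue_row_step A.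
Proof. by rewrite /lebesgue_row_step /pushforward. Qed.

Let mcons A : measurable A -> measurable (@cons_row n @^-1` A).
Proof. by move=> mA; rewrite -[X in measurable X]setTI; exact: measurable_cons_row. Qed.

Let step_sigma_additive : semi_sigma_additive lebesgue_row_step.
Proof.
move=> F mF tF mUF; rewrite /lebesgue_row_step /pushforward preimage_bigcup.
apply: measure_semi_sigma_additive.
- by move=> k; exact: mcons.
- apply/trivIsetP => /= i j _ _ ij; rewrite -preimage_setI.
  by move/trivIsetP : tF => /(_ _ _ _ _ ij) ->//; rewrite preimage_set0.
- by rewrite -preimage_bigcup; exact: mcons.
Qed.

HB.instance Definition _ := isMeasure.Build _ _ _ lebesgue_row_step
  step0 step_ge0 step_sigma_additive.

Lemma lebesgue_row_stepE (A : set (measurableTypeR R)) (B : set 'rV[R]_n) :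
  measurable A -> measurable B ->
  lebesgue_row_step
    [set x | A (x ord0 ord0) /\ B (\row_i x ord0 (lift ord0 i))] =
  lebesgue_measure A * m B.
Proof.
move=> mA mB; rewrite -product_measure1E//; congr ((_ \x m) _).
apply/seteqP; split=> -[x y] /=; rewrite cons_row0.
  move=> [Ax]; suff -> : \row_i cons_row (x, y) ord0 (lift ord0 i) = y by [].
  by apply/rowP => i; rewrite mxE cons_rowS.
move=> [Ax By]; split=> //.
suff -> : \row_i cons_row (x, y) ord0 (lift ord0 i) = y by [].
by apply/rowP => i; rewrite mxE cons_rowS.
Qed.

Let step_sigma_finite : sigma_finite setT lebesgue_row_step.
Proof.
have /sigma_finiteP[F [FT Fnd Foo]] := sigma_finiteT (@lebesgue_measure R).
have /sigma_finiteP[G [GT Gnd Goo]] := sigma_finiteT m.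
have mrowF k : measurable (F k) by case: (Foo k).
have mrowG k : measurable (G k) by case: (Goo k).
exists (fun k => [set x : 'rV[R]_n.+1 |
  F k (x ord0 ord0) /\ G k (\row_i x ord0 (lift ord0 i))]).
  apply/esym; rewrite -subTset => x _ /=.
  have : setT (x ord0 ord0) by []. rewrite FT => -[i _ Fi].
  have : setT (\row_i x ord0 (lift ord0 i)) by []. rewrite GT => -[j _ Gj].
  exists (maxn i j) => //; split.
    by move: Fi; apply/subsetPset/Fnd/leq_maxl.
  by move: Gj; apply/subsetPset/Gnd/leq_maxr.
move=> k; split; last first.
  rewrite lebesgue_row_stepE//.
  by rewrite lte_mul_pinfty// ?ge0_fin_numE//; [case: (Foo k)|case: (Goo k)].
apply: measurableI; rewrite -[X in measurable X]setTI.
  exact: measurable_row_coord.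
apply: (@measurable_fun_row _ _ _ (fun x : 'rV[R]_n.+1 => \row_i x ord0 (lift ord0 i))) => //.
move=> i; under eq_fun do rewrite mxE; exact: measurable_row_coord.
Qed.

HB.instance Definition _ := Measure_isSigmaFinite.Build _ _ _ lebesgue_row_step
  step_sigma_finite.

End step.

(* n-dimensional Lebesgue measure; in dimension 0, the unit mass at the point. *)
Fixpoint lebesgue_row n : {sigma_finite_measure set 'rV[R]_n -> \bar R} :=
  if n is k.+1 then lebesgue_row_step (lebesgue_row k) else \d_(0 : 'rV[R]_0).

Lemma lebesgue_row_box n (A : 'I_n -> set (measurableTypeR R)) :
  (forall i, measurable (A i)) ->
  lebesgue_row n [set x | forall i, A i (x ord0 i)] =
  (\prod_(i < n) lebesgue_measure (A i))%E.
Proof.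
elim: n A => [|n IH] A mA.
  rewrite big_ord0 /= diracE; apply/eqP; rewrite eqe pnatr_eq1 eqb1 inE /=.
  by case.
have mB : measurable
    [set x : 'rV[R]_n | forall i, A (lift ord0 i) (x ord0 i)].
  have -> : [set x : 'rV[R]_n | forall i, A (lift ord0 i) (x ord0 i)] =
      \bigcap_(i in [set: 'I_n])
        [set x : 'rV[R]_n | A (lift ord0 i) (x ord0 i)].
    by apply/seteqP; split=> [x Ax i _|x Ax i]; exact: Ax.
  apply: fin_bigcap_measurable => // i _; rewrite -[X in measurable X]setTI.
  exact: measurable_row_coord.
rewrite big_ord_recl -IH// -lebesgue_row_stepE//.
congr (lebesgue_row_step _ _); apply/seteqP; split=> x /= H.
  by split=> // i; rewrite mxE.
by move=> i; case: (unliftP ord0 i) => [j|] ->; [have := H.2 j; rewrite mxE|exact: H.1].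
Qed.

End lebesgue_row.

Section convex_geometry.
Context {R : realType}.

Definition dotp n (x y : 'rV[R]_n) : R := \sum_(i < n) x ord0 i * y ord0 i.

Definition convex_body n (K : set 'rV[R]_n) :=
  [/\ compact K, convex_set K & K° !=set0].

Definition symmetric_set n (K : set 'rV[R]_n) := forall x, K x -> K (- x).

Definition isotropic n (K : set 'rV[R]_n) :=
  [/\ lebesgue_row n K = 1%E,
      forall i, (\int[lebesgue_row n]_(x in K) (x ord0 i)%:E = 0)%E &
      exists2 L : R, 0 < L & forall theta : 'rV[R]_n, dotp theta theta = 1 ->
        (\int[lebesgue_row n]_(x in K) ((dotp x theta) ^+ 2)%:E = (L ^+ 2)%:E)%E].

(* The supremum is a maximum when K is compact and nonempty. *)
Definition support_function n (K : set 'rV[R]_n) (theta : 'rV[R]_n) : R :=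
  sup [set dotp x theta | x in K].

(* The rows of U form an orthonormal basis of the hyperplane theta^\perp. *)
Definition hyperplane_frame n (theta : 'rV[R]_n) (U : 'M[R]_(n.-1, n)) :=
  U *m U^T = 1%:M /\ U *m theta^T = 0.

(* The frame is obtained from a Householder reflection mapping the first
   basis vector to theta. *)
Lemma hyperplane_frame_exists n (theta : 'rV[R]_n) :
  dotp theta theta = 1 -> exists U, hyperplane_frame theta U.
Proof.
case: n theta => [|n] theta theta1.
  by exists 0; split; apply/matrixP => -[].
have thetaT : theta *m theta^T = 1%:M.
  apply/matrixP => i j; rewrite !ord1 !mxE -[RHS]theta1.
  by apply: eq_bigr => k _; rewrite mxE.
pose e : 'rV[R]_n.+1 := delta_mx ord0 ord0.
pose D : 'M[R]_(n, n.+1) := row' ord0 1%:M.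
have DDT : D *m D^T = 1%:M.
  apply/matrixP => i j; rewrite !mxE (bigD1 (lift ord0 i)) //= big1.
    by rewrite !mxE eqxx mul1r addr0 (inj_eq lift_inj) eq_sym.
  by move=> k ki; rewrite !mxE eq_sym (negbTE ki) mul0r.
have DeT : D *m e^T = 0.
  apply/matrixP => i j; rewrite !mxE big1 // => k _; rewrite !mxE.
  by case: (eqVneq k ord0) => [->|]; rewrite ?mul0r ?mulr0 ?andbF ?mulr0.
have eeT : e *m e^T = 1%:M.
  by rewrite trmx_delta mul_delta_mx; apply/matrixP => i j; rewrite !ord1 !mxE.
have [thetae|thetae] := eqVneq theta e.
  by exists D; rewrite /hyperplane_frame thetae.
have [v vE] : exists v, v = theta - e by exists (theta - e).
pose c := (v *m v^T) ord0 ord0.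
have vvT : v *m v^T = c%:M by rewrite [LHS]mx11_scalar.
have c0 : c != 0.
  apply: contra thetae; rewrite /c mxE psumr_eq0 => [/allP v0|k _]; last first.
    by rewrite [v^T _ _]mxE -expr2 sqr_ge0.
  rewrite -subr_eq0 -vE; apply/eqP/rowP => k; rewrite [RHS]mxE.
  have := v0 k (mem_index_enum _); rewrite [v^T _ _]mxE -expr2 sqrf_eq0.
  by move/eqP.
have [s se] : exists s : R, e *m theta^T = s%:M.
  by exists ((e *m theta^T) ord0 ord0); exact: mx11_scalar.
have se' : theta *m e^T = s%:M by rewrite -[LHS]trmxK trmx_mul trmxK se tr_scalar_mx.
have vtheta : v *m theta^T = (1 - s)%:M.
  by rewrite vE mulmxBl thetaT se raddfB.
have cE : c = 2 * (1 - s).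
  rewrite /c {2}vE linearB/= mulmxBr vtheta vE mulmxBl se' eeT !mxE /=; ring.
pose H : 'M[R]_n.+1 := 1%:M - (2 / c) *: (v^T *m v).
have HT : H^T = H.
  by rewrite /H linearB/= trmx1 linearZ/= trmx_mul trmxK.
have HH : H *m H = 1%:M.
  have ww : (v^T *m v) *m (v^T *m v) = c *: (v^T *m v).
    by rewrite mulmxA -[_ *m v^T]mulmxA vvT mul_mx_scalar scalemxAl.
  rewrite /H mulmxBl mul1mx mulmxBr mulmx1 -scalemxAl -scalemxAr ww !scalerA.
  have -> : 2 / c * (2 / c) * c = 2 / c + 2 / c by field.
  by rewrite scalerDl opprB addrK subrK.
have He : H *m theta^T = e^T.
  have s1 : 1 - s != 0 by apply: contra c0 => /eqP s1; rewrite cE s1 mulr0.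
  rewrite /H mulmxBl mul1mx -scalemxAl -mulmxA vtheta mul_mx_scalar scalerA cE.
  by rewrite invfM mulrA divff ?pnatr_eq0// mul1r mulVf// scale1r vE linearB/= subKr.
exists (D *m H); split; rewrite ?trmx_mul -!mulmxA ?He//.
by rewrite [H *m _]mulmxA HT HH mul1mx.
Qed.

(* (n-1)-dimensional volume of K `&` {x | <x, theta> = t}: the hyperplane is
   identified with R^(n-1) by y |-> t theta + y U.  The choice of the frame U
   is immaterial since Lebesgue measure is invariant under orthogonal maps. *)
Definition section_volume n (K : set 'rV[R]_n) (theta : 'rV[R]_n) (t : R) :
    \bar R :=
  let U := xget 0 [set U | hyperplane_frame theta U] in
  lebesgue_row n.-1 [set y | K (t *: theta + y *m U)].

(* For n = 1 the exponent 1 / (n - 1) is read as 0^-1 = 0, so that this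
   function is then constant equal to 1. *)
Definition section_radius n (K : set 'rV[R]_n) (theta : 'rV[R]_n) (t : R) : R :=
  fine (section_volume K theta t) `^ (n.-1%:R)^-1.

(* Inverse of h : `[0, b] -> R; it takes the value b outside the range of h.
   When h is decreasing and h b = 0 this extends h^-1 monotonically to the
   negative reals. *)
Definition inverse_on (b : R) (h : R -> R) : R -> R :=
  'pinv_(fun=> b) `[0, b]%classic h.

Lemma inverse_onK b h s : (exists2 t, 0 <= t <= b & h t = s) ->
  0 <= inverse_on b h s <= b /\ h (inverse_on b h s) = s.
Proof.
move=> [t t0b hts]; have s_im : (h @` `[0, b]%classic) s.
  by exists t => //=; rewrite in_itv.
rewrite /inverse_on /pinv_ splitV; case: (oinvP _ s_im) => x /=.
by rewrite in_itv.
Qed.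

Lemma inverse_on_out b h s : ~ (exists2 t, 0 <= t <= b & h t = s) ->
  inverse_on b h s = b.
Proof.
move=> s_out; rewrite /inverse_on /pinv_ splitV oinv_surj.
by case: pselect.
Qed.

End convex_geometry.

Section random_vectors.
Context d (Omega : measurableType d) (R : realType) (P : probability Omega R).

Definition uniform_in n (K : set 'rV[R]_n) (X : Omega -> 'rV[R]_n) :=
  forall A : set 'rV[R]_n, measurable A ->
  P (X @^-1` A) = (lebesgue_row n (K `&` A) * (fine (lebesgue_row n K))^-1%:E)%E.

(* Product rule over the whole family; letting A i = setT gives every
   subfamily. *)
Definition independent_vectors N n (X : 'I_N -> Omega -> 'rV[R]_n) :=
  forall A : 'I_N -> set 'rV[R]_n, (forall i, measurable (A i)) ->
  P (\bigcap_(i in [set: 'I_N]) (X i @^-1` A i)) =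
  (\prod_(i < N) P (X i @^-1` A i))%E.

End random_vectors.

(* Main.v *)
Require Import Defs.
From HB Require Import structures.
From mathcomp Require Import all_boot all_order all_algebra.
From mathcomp Require Import all_classical all_reals all_analysis.
From mathcomp Require Import measurable_realfun ring lra.

(** Write [n] for the dimension, [H = h 0 ^+ n.-1] for the volume of the
central section and [delta = 8 * ln N / n], and suppose that
[t0 = h^-1 (h 0 * (1 - delta))] is an interior point of [0, h_K].  When the
argument of [h^-1] has no preimage, or when [h^-1] takes the value [h_K], the
right-hand side is twice [h_K] and the bound is obvious.

Monotonicity of [- h' / t] says that [h] is a concave function of [t ^+ 2].  Its
chord between [0] and [t0] therefore gives
[h s <= h 0 * (1 - delta * (s / t0) ^+ 2)] beyond [t0] and the reverse
inequality before [t0] ([square_chord_le], [square_chord_ge]).  Three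
consequences follow.
 - As [h] is nonnegative, [delta * h_K ^+ 2 <= t0 ^+ 2]: the support of the
   marginal is at most about [sqrt n] times longer than [t0].
 - On [0, t0 / n] one has [h >= h 0 * (1 - n ^- 2)], so the sections there have
   volume at least [H / 2]; as the body has volume [1], [H <= 2 * n / t0].
 - Beyond [t0] the sections have volume at most
   [H * (1 - delta) ^+ n.-1 <= H * N ^- 4].
Integrating the last bound over the tail, the probability that
[`|<X, theta>|] exceeds [t0] is at most [2 * h_K * H * N ^- 4].  Since the
maximum is at most [t0] plus [h_K] for every index whose projection exceeds
[t0], a union bound finishes: the polynomial losses in [n <= N] are absorbed by
[N ^- 4].  The constants are [alpha = 8] and [C = 2].

The geometric input is Cavalieri's principle for sections orthogonal to [theta]
([lebesgue_row_slices]), which rests on the invariance of Lebesgue measure under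
orthogonal maps ([lebesgue_row_orthogonal]).  Lower semicontinuity of [h] at [0],
an endpoint of the interval of differentiability, comes from comparing a section
with the cone over the central one ([section_radius_cone]). *)

Set Implicit Arguments.
Unset Strict Implicit.
Unset Printing Implicit Defensive.

Import Order.TTheory GRing.Theory Num.Theory.
Import numFieldNormedType.Exports.

Local Open Scope classical_set_scope.
Local Open Scope ring_scope.

(** * Linear changes of variables in Lebesgue measure *)

Section haar.
Context {R : realType}.
Local Notation mu := (@lebesgue_measure R).

Lemma lebesgue_measure_translate (a : R) (A : set (measurableTypeR R)) :
  measurable A -> mu [set x | A (x + a)] = mu A.
Proof.
move=> mA.
have mD : measurable_fun [set: measurableTypeR R]
    ((fun x => x + a) : measurableTypeR R -> measurableTypeR R).
  exact: measurable_funD.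
pose f : {mfun measurableTypeR R >-> measurableTypeR R} :=
  HB.pack ((fun x => x + a) : measurableTypeR R -> measurableTypeR R)
   (isMeasurableFun.Build _ _ _ _ _ mD).
apply/esym; apply: (lebesgue_measure_unique (mu := pushforward mu f)) => //.
move=> _ [[b c]] _ <-; rewrite /pushforward.
rewrite [X in _ = mu X](_ : _ = `]b - a, c - a]%classic); last first.
  by apply/seteqP; split => x /=; rewrite !in_itv/= ltrBlDr lerBrDr.
rewrite !lebesgue_measure_itv/= !lte_fin ltrD2r.
by case: ifPn => // _; rewrite -!EFinB; congr EFin; ring.
Qed.

Lemma measurable_row_sum d (T : measurableType d) n (f : 'I_n -> T -> R) :
  (forall i, measurable_fun [set: T] (f i)) ->
  measurable_fun [set: T] (fun x => \sum_(i < n) f i x).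
Proof. by move=> mf; exact: measurable_sum. Qed.

Lemma measurable_row_preimage n d (T : measurableType d) (f : T -> 'rV[R]_n) A :
  (forall i, measurable_fun [set: T] (fun x => f x ord0 i)) ->
  measurable A -> measurable [set x | A (f x)].
Proof.
move=> mf mA; rewrite -[X in measurable X]setTI.
exact: (measurable_fun_row mf).
Qed.

Lemma measurable_mulmx_coord n m d (T : measurableType d) (f : T -> 'rV[R]_n)
    (V : 'M[R]_(n, m)) i :
  (forall i, measurable_fun [set: T] (fun x => f x ord0 i)) ->
  measurable_fun [set: T] (fun x => (f x *m V) ord0 i).
Proof.
move=> mf; under eq_fun do rewrite mxE.
by apply: measurable_row_sum => j; apply: measurable_funM.
Qed.

(** Induction on the dimension: both sides are product measures, so it is
enough to compare them on rectangles. *)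
Lemma lebesgue_row_translate n (v : 'rV[R]_n) (A : set 'rV[R]_n) :
  measurable A -> lebesgue_row n [set x | A (x + v)] = lebesgue_row n A.
Proof.
elim: n v A => [|n IH] v A mA.
  by congr (lebesgue_row 0 _); apply/funext => x /=; rewrite !thinmx0.
pose v' : 'rV[R]_n := \row_i v ord0 (lift ord0 i).
pose g (p : measurableTypeR R * 'rV[R]_n) : measurableTypeR R * 'rV[R]_n :=
  (p.1 + v ord0 ord0, p.2 + v').
have mg : measurable_fun setT g.
  apply/measurable_fun_pairP; split => /=.
    by apply: measurable_funD => //; exact: measurable_fst.
  apply: measurable_fun_row => i; under eq_fun do rewrite /g /= mxE.
  apply: measurable_funD => //.
  exact: (measurableT_comp (@measurable_row_coord R n i) measurable_snd).
pose G : {mfun (measurableTypeR R * 'rV[R]_n)%type >->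
    (measurableTypeR R * 'rV[R]_n)%type} :=
  HB.pack g (isMeasurableFun.Build _ _ _ _ _ mg).
have mC : measurable (@cons_row R n @^-1` A).
  by rewrite -[X in measurable X]setTI; exact: measurable_cons_row.
transitivity (pushforward (mu \x lebesgue_row n)%E G (@cons_row R n @^-1` A)).
  rewrite /= /lebesgue_row_step /pushforward; congr ((_ \x _)%E _).
  apply/funext => -[t y] /=; congr (A _).
  apply/rowP => i; rewrite [LHS]mxE; case: (unliftP ord0 i) => [j|] ->.
    by rewrite !cons_rowS /= !mxE.
  by rewrite !cons_row0.
rewrite [RHS]/= /lebesgue_row_step [RHS]/pushforward.
apply/esym/product_measure_unique => // B C mB mC'.
rewrite /pushforward.
transitivity ((mu \x lebesgue_row n)%E
  ([set x | B (x + v ord0 ord0)] `*` [set y | C (y + v')])) => //.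
rewrite product_measure1E//.
- by congr (_ * _)%E; [exact: lebesgue_measure_translate|exact: IH].
- rewrite -[X in measurable X]setTI.
  by apply: measurable_funD => //.
- apply: measurable_row_preimage => // i; under eq_fun do rewrite mxE.
  by apply: measurable_funD => //; exact: measurable_row_coord.
Qed.

(** The usual proof of uniqueness of Haar measure, for the translation invariant
measure [fun B => lebesgue_row n [set y | B (y *m V)]].  Both sides are the
measure of the set of pairs [(x, y)] with [A x] and [B (x + y *m V)]: integrate
over [y] first, or substitute [x - y *m V] for [x] and integrate over [y] again.
Choosing [A] well identifies the factor by which [V] scales volumes, without
determinants. *)
Lemma lebesgue_row_linear n (V W : 'M[R]_n) (A B : set 'rV[R]_n) :
  V *m W = 1%:M -> measurable A -> measurable B ->
  (lebesgue_row n A * lebesgue_row n [set y | B (y *m V)] =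
   lebesgue_row n B * lebesgue_row n [set y | A (- (y *m V))%R])%E.
Proof.
move=> VW mA mB; have WV : W *m V = 1%:M by exact: mulmx1C.
set L := lebesgue_row n.
have mcoord i := @measurable_row_coord R n i.
have mfst i : measurable_fun [set: 'rV[R]_n * 'rV[R]_n] (fun p => p.1 ord0 i).
  exact: (measurableT_comp (mcoord i) measurable_fst).
have msnd i : measurable_fun [set: 'rV[R]_n * 'rV[R]_n] (fun p => p.2 ord0 i).
  exact: (measurableT_comp (mcoord i) measurable_snd).
have mBV : measurable [set y | B (y *m V)].
  by apply: measurable_row_preimage => // i; exact: measurable_mulmx_coord.
have mAV : measurable [set y | A (- (y *m V))%R].
  apply: measurable_row_preimage => // i; under eq_fun do rewrite mxE.
  by apply: measurableT_comp => //; exact: measurable_mulmx_coord.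
have swap (E : set ('rV[R]_n * 'rV[R]_n)) : measurable E ->
    (\int[L]_x L (xsection E x) = \int[L]_y L (ysection E y))%E.
  move=> mE; have := indic_fubini_tonelli L L mE.
  by rewrite indic_fubini_tonelli_FE// indic_fubini_tonelli_GE.
(* [E2] is the image of [E1] under the shear [(x, y) |-> (x + y *m V, y)], which
   translates every horizontal section. *)
pose E1 : set ('rV[R]_n * 'rV[R]_n) := [set p | A p.1 /\ B (p.1 + p.2 *m V)].
pose E2 : set ('rV[R]_n * 'rV[R]_n) := [set p | A (p.1 - p.2 *m V) /\ B p.1].
have mE1 : measurable E1.
  apply: measurableI; first by apply: measurable_row_preimage.
  apply: measurable_row_preimage => // i; under eq_fun do rewrite mxE.
  by apply: measurable_funD => //; exact: measurable_mulmx_coord.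
have mE2 : measurable E2.
  apply: measurableI; last by apply: measurable_row_preimage.
  apply: measurable_row_preimage => // i; under eq_fun do rewrite 2!mxE.
  by apply: measurable_funB => //; exact: measurable_mulmx_coord.
have I1 : (\int[L]_x L (xsection E1 x) = L A * L [set y | B (y *m V)])%E.
  rewrite (eq_integral (fun x => (\1_A x)%:E * L [set y | B (y *m V)]))%E.
    by rewrite ge0_integralZr ?integral_indic ?setIT//; exact: measurableT_comp.
  move=> x _; rewrite indicE /xsection; have [xA|xA] := boolP (x \in A).
    rewrite mul1e -(lebesgue_row_translate (x *m W) mBV).
    congr (L _); apply/funext => y /=.
    rewrite mulmxDl -mulmxA WV mulmx1 addrC.
    by rewrite inE /E1 /=; apply/propext; split => [[]|H]//; split => //; exact/set_mem.
  rewrite mul0e -(measure0 L); congr (L _); apply/seteqP; split => // y /=.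
  by rewrite inE => -[/= /mem_set]; rewrite (negbTE xA).
have I2 : (\int[L]_x L (xsection E2 x) = L B * L [set y | A (- (y *m V))%R])%E.
  rewrite (eq_integral (fun x => (\1_B x)%:E * L [set y | A (- (y *m V))%R]))%E.
    by rewrite ge0_integralZr ?integral_indic ?setIT//; exact: measurableT_comp.
  move=> x _; rewrite indicE /xsection; have [xB|xB] := boolP (x \in B).
    rewrite mul1e -(lebesgue_row_translate (- x *m W) mAV).
    congr (L _); apply/funext => y /=.
    rewrite mulmxDl -mulmxA WV mulmx1 opprD opprK addrC.
    by rewrite inE /E2 /=; apply/propext; split => [[]|H]//; split => //; exact/set_mem.
  rewrite mul0e -(measure0 L); congr (L _); apply/seteqP; split => // y /=.
  by rewrite inE => -[_ /= /mem_set]; rewrite (negbTE xB).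
rewrite -I1 -I2 !swap//; apply: eq_integral => y _.
have mS : measurable (ysection E2 y) by exact: measurable_ysection.
rewrite -(lebesgue_row_translate (y *m V) mS).
congr (L _); apply/funext => x /=.
rewrite /ysection /=; apply/propext; split; rewrite !inE /E1 /E2 /= addrK//.
Qed.

End haar.

Section geometry.
Context {R : realType}.
Local Notation mu := (@lebesgue_measure R).

Lemma dotpE n (x y : 'rV[R]_n) : dotp x y = (x *m y^T) ord0 ord0.
Proof. by rewrite mxE; apply: eq_bigr => i _; rewrite mxE. Qed.

Lemma dotp_orthogonal n m (V : 'M[R]_(n, m)) (x y : 'rV[R]_n) :
  V *m V^T = 1%:M -> dotp (x *m V) (y *m V) = dotp x y.
Proof. by move=> VV; rewrite !dotpE trmx_mul mulmxA -(mulmxA x) VV mulmx1. Qed.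

Lemma lebesgue_row_cube n (c : R) : 0 <= c ->
  lebesgue_row n [set x : 'rV[R]_n | forall i, `|x ord0 i| <= c] = ((c + c) ^+ n)%:E.
Proof.
move=> c0.
transitivity (\prod_(i < n) mu `[(- c)%R, c]%classic)%E.
  rewrite -lebesgue_row_box; last by move=> i; exact: measurable_itv.
  congr (lebesgue_row n _); apply/funext => x /=; apply/propext; split => H i.
    by rewrite in_itv/= -ler_norml.
  by rewrite ler_norml; have := H i; rewrite in_itv.
rewrite lebesgue_measure_itv/= lte_fin.
rewrite big_const_ord.
have -> : (if (- c < c)%R then c%:E - (- c)%:E else 0)%E = (c + c)%:E.
  case: ifPn => [_|]; first by rewrite -EFinB opprK.
  by rewrite -leNgt => cN; congr EFin; lra.
elim: n => [//|n IH]; by rewrite iterS IH exprS.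
Qed.

Lemma measurable_cube n (c : R) :
  measurable [set x : 'rV[R]_n | forall i, `|x ord0 i| <= c].
Proof.
rewrite (_ : mkset _ = \bigcap_(i in [set: 'I_n])
    [set x : 'rV[R]_n | `|x ord0 i| <= c]).
  apply: fin_bigcap_measurable => // i _; rewrite -[X in measurable X]setTI.
  have mc := @measurable_row_coord R n i.
  have := measurableT_comp (@normr_measurable R setT) mc.
  by move=> /(_ measurableT `]-oo, c]%classic (measurable_itv _)).
by apply/seteqP; split => [x Ax i _|x Ax i]; exact: Ax.
Qed.

(** The scaling factor is read off a cube. *)
Lemma lebesgue_row_scale n (c : R) (B : set 'rV[R]_n) : 0 < c ->
  measurable B ->
    lebesgue_row n B = ((c ^+ n)%:E * lebesgue_row n [set y | B (c *: y)])%E.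
Proof.
move=> c0 mB.
pose A := [set x : 'rV[R]_n | forall i, `|x ord0 i| <= c].
have mA : measurable A by exact: measurable_cube.
have cV : (c%:M : 'M[R]_n) *m (c^-1)%:M = 1%:M.
  by rewrite -scalar_mxM divff// gt_eqF.
have := lebesgue_row_linear cV mA mB.
rewrite lebesgue_row_cube ?(ltW c0)//.
rewrite [X in (_ = _ * lebesgue_row n X)%E -> _](_ : _ =
    [set x : 'rV[R]_n | forall i, `|x ord0 i| <= 1]).
  rewrite lebesgue_row_cube//.
  rewrite [X in (_ * lebesgue_row n X = _)%E -> _](_ : _ =
    [set y | B (c *: y)]); last first.
    by apply/funext => y /=; rewrite mul_mx_scalar.
  have -> : c + c = c * (1 + 1) by ring.
  rewrite exprMn mulrC EFinM -muleA [RHS]muleC.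
  have p0 : (0 < (1 + 1) ^+ n :> R) by rewrite exprn_gt0.
  move=> /(congr1 (fun z => ((1 + 1) ^- n)%:E * z)%E).
  by rewrite !(muleA ((1 + 1) ^- n)%:E) -EFinM mulVf ?gt_eqF// !mul1e => <-.
apply/funext => y; apply/propext; split => H i /=.
  move: (H i); rewrite mul_mx_scalar !mxE normrN normrM gtr0_norm//.
  by rewrite ger_pMr.
rewrite mul_mx_scalar !mxE normrN normrM gtr0_norm//.
by rewrite ger_pMr//; exact: H.
Qed.

Lemma measurable_dotp n d (T : measurableType d) (f g : T -> 'rV[R]_n) :
  (forall i, measurable_fun [set: T] (fun x => f x ord0 i)) ->
  (forall i, measurable_fun [set: T] (fun x => g x ord0 i)) ->
  measurable_fun [set: T] (fun x => dotp (f x) (g x)).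
Proof.
by move=> mf mg; apply: measurable_row_sum => i; exact: measurable_funM.
Qed.

Lemma measurable_unit_ball n : measurable [set x : 'rV[R]_n | dotp x x <= 1].
Proof.
have mc i := @measurable_row_coord R n i.
have := @measurable_dotp n _ _ id id mc mc.
move=> /(_ measurableT `]-oo, 1]%classic (measurable_itv _)).
by rewrite setTI set_itvNyc.
Qed.

(** The ball lies between the cubes of half-sides [n^-1] and [1]. *)
Lemma lebesgue_unit_ball n : (0 < n)%N ->
  (0 < lebesgue_row n [set x : 'rV[R]_n | (dotp x x <= 1)%R] < +oo)%E.
Proof.
have mball := @measurable_unit_ball n.
move=> n0; apply/andP; split; last first.
  apply: (@le_lt_trans _ _ (lebesgue_row n
    [set x : 'rV[R]_n | forall i, `|x ord0 i| <= 1])); last first.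
    by rewrite lebesgue_row_cube// ltry.
  apply: le_measure; rewrite ?inE//; first exact: measurable_cube.
  move=> x /= x1 i; rewrite -(@ler_pXn2r _ 2) ?nnegrE// expr1n real_normK ?num_real//.
  apply: le_trans x1; rewrite /dotp (bigD1 i)//= -expr2 lerDl.
  by apply: sumr_ge0 => j _; rewrite -expr2 sqr_ge0.
apply: (@lt_le_trans _ _ (lebesgue_row n
    [set x : 'rV[R]_n | forall i, `|x ord0 i| <= n%:R^-1])).
  by rewrite lebesgue_row_cube// lte_fin exprn_gt0// addr_gt0// invr_gt0 ltr0n.
apply: le_measure; rewrite ?inE//; first exact: measurable_cube.
move=> x /= xn; rewrite /dotp.
apply: (@le_trans _ _ (\sum_(i < n) n%:R^-1)).
  apply: ler_sum => i _; rewrite -expr2 -real_normK ?num_real// expr2.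
  apply: (@le_trans _ _ (1 * n%:R^-1)); last by rewrite mul1r.
  rewrite ler_pM//; apply: (le_trans (xn i)).
  by rewrite invf_le1 ?ltr0n// ler1n.
by rewrite sumr_const card_ord -[_ *+ n]mulr_natr mulVf// pnatr_eq0 -lt0n.
Qed.

(** An orthogonal map preserves the unit ball, whose measure is positive and
finite, so its scaling factor is [1]. *)
Lemma lebesgue_row_orthogonal n (V : 'M[R]_n) (B : set 'rV[R]_n) : (0 < n)%N ->
  V *m V^T = 1%:M -> measurable B ->
  lebesgue_row n [set y | B (y *m V)] = lebesgue_row n B.
Proof.
move=> n0 VV mB; have mD := @measurable_unit_ball n.
have /andP[D0 Doo] := lebesgue_unit_ball n0.
have := lebesgue_row_linear VV mD mB.
rewrite [X in (_ = _ * lebesgue_row n X)%E -> _](_ : _ =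
    [set x : 'rV[R]_n | dotp x x <= 1]); last first.
  by apply/funext => y /=; rewrite -mulNmx dotp_orthogonal//
    !dotpE linearN/= mulNmx mulmxN opprK.
have Dfin : lebesgue_row n [set x : 'rV[R]_n | (dotp x x <= 1)%R] \is a fin_num.
  by rewrite ge0_fin_numE.
rewrite [RHS]muleC => DE; apply/eqP.
by rewrite eq_le; apply/andP; split; rewrite -(lee_pmul2l Dfin D0) DE.
Qed.

Lemma lebesgue_row_opp n (B : set 'rV[R]_n) : (0 < n)%N -> measurable B ->
  lebesgue_row n [set y | B (- y)] = lebesgue_row n B.
Proof.
move=> n0 mB; rewrite -[RHS](@lebesgue_row_orthogonal _ (- 1%:M))//.
  by congr (lebesgue_row n _); apply/funext => y /=; rewrite mulmxN mulmx1.
by rewrite linearN/= trmx1 mulmxN mulNmx mulmx1 opprK.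
Qed.

End geometry.

(** * Borel sets and slices of row vector spaces *)

Section sections.
Context {R : realType}.
Local Notation mu := (@lebesgue_measure R).

(** An open set is the union of the rational cubes that it contains, so the sigma
algebra generated by the coordinates contains the Borel sets. *)
Lemma open_measurable_row n (U : set 'rV[R]_n) : open U -> measurable U.
Proof.
move=> oU.
pose box (p : 'rV[rat]_n * nat) : set 'rV[R]_n :=
  [set x | forall i, `|x ord0 i - ratr (p.1 ord0 i)| < p.2.+1%:R^-1].
have mbox p : measurable (box p).
  rewrite (_ : box p = \bigcap_(i in [set: 'I_n])
      [set x : 'rV[R]_n | `|x ord0 i - ratr (p.1 ord0 i)| < p.2.+1%:R^-1]).
    apply: fin_bigcap_measurable => // i _; rewrite -[X in measurable X]setTI.
    have mc := measurable_funB (@measurable_row_coord R n i)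
      (measurable_cst (ratr (p.1 ord0 i) : R)).
    have := measurableT_comp (@normr_measurable R setT) mc.
    by move=> /(_ measurableT `]-oo, p.2.+1%:R^-1[%classic (measurable_itv _)).
  by apply/seteqP; split => [x Ax i _|x Ax i]; exact: Ax.
have -> : U = \bigcup_p (if `[< box p `<=` U >] then box p else set0).
  apply/seteqP; split => [x Ux|x [p _]]; last by case: asboolP => [+ bx|//]; apply.
  have /nbhs_ballP[e e0 xeU] : nbhs x U by exact: open_nbhs_nbhs.
  have [k ke] : exists k : nat, k.+1%:R^-1 < e / 2.
    have := @near_infty_natSinv_lt R (PosNum (divr_gt0 e0 (ltr0n _ 2))).
    by case=> k _ /(_ k); rewrite /= leqnn => /(_ isT); exists k.
  have [c ck] : exists c : R, c = k.+1%:R^-1 by exists k.+1%:R^-1.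
  have c0 : 0 < c by rewrite ck invr_gt0 ltr0n.
  have /choice[q Hq] (i : 'I_n) : exists q : rat, `|x ord0 i - ratr q| < c.
    have : x ord0 i - c < x ord0 i + c by lra.
    move=> /rat_in_itvoo[q]; rewrite in_itv/= => /andP[q1 q2].
    by exists q; rewrite ltr_norml; apply/andP; split; lra.
  exists (\row_i q i, k) => //; rewrite asboolT.
    by move=> i /=; rewrite mxE -ck.
  move=> y /= yq; apply: xeU; split => // i j.
  rewrite ord1; have := yq j; have := Hq j; rewrite mxE -ck /ball /= => h1 h2.
  rewrite -ck in ke.
  apply: (le_lt_trans (ler_distD (ratr (q j)) _ _)).
  by rewrite (distrC _ (y _ _)); apply: lt_trans (ltrD h1 h2) _; lra.
by apply: countable_bigcupT_measurable => [|p]; [exact: countableP|case: asboolP].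
Qed.

Lemma compact_measurable_row n (K : set 'rV[R]_n) : compact K -> measurable K.
Proof.
move=> cK; rewrite -[K]setCK; apply: measurableC.
by apply: open_measurable_row; apply: closed_openC; apply: compact_closed.
Qed.

Lemma compact_row_bounded n (K : set 'rV[R]_n) : compact K ->
  exists2 M : R, 0 < M & forall x, K x -> forall i, `|x ord0 i| <= M.
Proof.
move=> /compact_bounded[M [_ MK]]; exists (`|M| + 1).
  by rewrite ltr_pwDr.
move=> x Kx i; have /(_ (`|M| + 1)) := MK.
rewrite (le_lt_trans (ler_norm _))// ?ltrDl// => /(_ isT x Kx).
apply: le_trans.
have /mapP[j Hj ->] : `|x ord0 i| \in [seq `|x y.1 y.2| | y : 'I_1 * 'I_n].
  by apply/mapP; exists (ord0, i) => //=; rewrite mem_enum.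
by rewrite [leRHS]/Num.norm /= mx_normrE; apply/bigmax_geP; right => /=; exists j.
Qed.

Lemma convex_setP n (K : set 'rV[R]_n) : convex_set K ->
  forall x y (l : R), 0 <= l <= 1 -> K x -> K y -> K (l *: x + (1 - l) *: y).
Proof.
move=> cK x y l /andP[l0 l1] Kx Ky.
have := cK x y (Itv01 l0 l1) (mem_set Kx) (mem_set Ky).
by rewrite inE.
Qed.

Lemma cons_rowE n (t : measurableTypeR R) (y : 'rV[R]_n) :
  cons_row (t, y) = row_mx (t : R)%:M y.
Proof.
apply/rowP => i; case: (unliftP ord0 i) => [j|] ->.
  rewrite cons_rowS (_ : lift _ _ = rshift 1 j); last exact: val_inj.
  by rewrite (@row_mxEr _ _ 1 n).
rewrite cons_row0 (_ : (ord0 : 'I_n.+1) = lshift n (ord0 : 'I_1)).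
  by rewrite (@row_mxEl _ _ 1 n) mxE.
exact: val_inj.
Qed.

(** Cavalieri's principle in the direction [theta]: the rows [theta, U] form an
orthogonal matrix, which reduces the claim to the definition of
[lebesgue_row m.+1] as a product measure. *)
Lemma lebesgue_row_slices m (theta : 'rV[R]_m.+1) (U : 'M[R]_(m, m.+1))
    (B : set 'rV[R]_m.+1) :
  dotp theta theta = 1 -> hyperplane_frame theta U -> measurable B ->
  lebesgue_row m.+1 B =
  (\int[mu]_t lebesgue_row m [set y | B (t *: theta + y *m U)%R])%E.
Proof.
move=> theta1 [UU Utheta] mB.
pose V : 'M[R]_m.+1 := col_mx theta U.
have VV : V *m V^T = 1%:M.
  rewrite /V (@tr_col_mx _ 1 m) (@mul_col_row _ 1 m _ 1 m) UU Utheta.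
  rewrite -[theta *m U^T]trmxK trmx_mul trmxK Utheta trmx0.
  rewrite (_ : theta *m theta^T = 1%:M); first by rewrite -(@scalar_mx_block _ 1 m).
  by rewrite [LHS]mx11_scalar -dotpE theta1.
rewrite -(lebesgue_row_orthogonal (ltn0Sn m) VV mB).
rewrite [LHS]/= /lebesgue_row_step /pushforward /product_measure1.
apply: eq_integral => t _ /=; congr (lebesgue_row m _).
apply/funext => y; rewrite /xsection /= inE /= cons_rowE.
by rewrite /V (@mul_row_col _ 1 1 m) mul_scalar_mx.
Qed.

End sections.

(** * Sections of a symmetric convex body *)

Section body.
Context {R : realType} (m : nat).
Variables (K : set 'rV[R]_m.+1) (theta : 'rV[R]_m.+1).
Hypothesis cptK : compact K.
Hypothesis cvxK : convex_set K.
Hypothesis intK : K° !=set0.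
Hypothesis symK : symmetric_set K.
Hypothesis volK : lebesgue_row m.+1 K = 1%E.
Hypothesis theta1 : dotp theta theta = 1.
Local Notation mu := (@lebesgue_measure R).
Local Notation h := (section_radius K theta).
Local Notation hK := (support_function K theta).
Local Notation v := (section_volume K theta).

Let mK : measurable K := compact_measurable_row cptK.

(** A symmetric convex set with an interior point [x0] has the origin in its
interior: average [x0 + 2 *: x] and [- x0]. *)
Lemma cube_in_body :
  exists2 r : R, 0 < r & forall x : 'rV[R]_m.+1, (forall i, `|x ord0 i| <= r) -> K x.
Proof.
have [x0] := intK; rewrite /interior => /nbhs_ballP[e /= e0 eK].
have Kx0 : K x0 by apply: eK; exact: ballxx.
exists (e / 4); first by rewrite divr_gt0.
move=> x xe; have -> : x = 2^-1 *: (x0 + 2 *: x) + (1 - 2^-1) *: (- x0).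
  by apply/rowP => i; rewrite !mxE; field.
apply: convex_setP => //; first by lra.
  apply: eK; split=> // i j; rewrite /ball /= !mxE ord1 opprD addrA subrr add0r.
  rewrite normrN normrM gtr0_norm//; have := xe j; lra.
exact: symK.
Qed.

Lemma dotp_le_support x : K x -> `|dotp x theta| <= hK.
Proof.
have [M M0 KM] := compact_row_bounded cptK.
have ub : has_ubound [set dotp x theta | x in K].
  exists (\sum_(i < m.+1) M * `|theta ord0 i|) => _ [y Ky <-].
  apply: ler_sum => i _; rewrite (le_trans (ler_norm _))// normrM.
  by rewrite ler_wpM2r//; exact: KM.
have le x' : K x' -> dotp x' theta <= hK.
  by move=> Kx'; apply: sup_ubound => //; exists x'.
move=> Kx; rewrite ler_norml le// andbT lerNl.
rewrite -[X in X <= _](_ : dotp (- x) theta = _); first exact/le/symK.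
by rewrite !dotpE mulNmx mxE.
Qed.

Lemma section_frame : exists2 U, hyperplane_frame theta U &
  forall t, v t = lebesgue_row m [set y | K (t *: theta + y *m U)].
Proof.
exists (xget 0 [set U | hyperplane_frame theta U]) => //.
by have [U HU] := hyperplane_frame_exists theta1; apply: (xgetPex 0); exists U.
Qed.

Lemma dotp_slice U t (y : 'rV[R]_m) : hyperplane_frame theta U ->
  dotp (t *: theta + y *m U) theta = t.
Proof.
move=> [_ Ut]; rewrite dotpE mulmxDl -mulmxA Ut mulmx0 addr0 -scalemxAl mxE -dotpE.
by rewrite theta1 mulr1.
Qed.

Lemma measurable_slice (B : set 'rV[R]_m.+1) (U : 'M[R]_(m, m.+1)) t : measurable B ->
  measurable [set y | B (t *: theta + y *m U)].
Proof.
move=> mB; apply: measurable_row_preimage => // i; under eq_fun do rewrite mxE.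
apply: measurable_funD => //.
by apply: measurable_mulmx_coord => j; exact: measurable_row_coord.
Qed.

(** Sections are bounded because [y] is recovered from [t *: theta + y *m U] by
multiplication by [U^T]. *)
Lemma section_volume_fin t : v t \is a fin_num.
Proof.
have [U UH ->] := section_frame; have [M M0 KM] := compact_row_bounded cptK.
rewrite ge0_fin_numE//.
pose c := \sum_(i < m) \sum_(j < m.+1) M * `|U i j|.
have c0 : 0 <= c by do 2!apply: sumr_ge0 => ? _; rewrite mulr_ge0// ltW.
apply: (@le_lt_trans _ _ (lebesgue_row m
    [set y : 'rV[R]_m | forall i, `|y ord0 i| <= c])).
  apply: le_measure; rewrite ?inE; [exact: measurable_slice|exact: measurable_cube|].
  move=> y /= Ky i; have [UU Ut] := UH.
  have -> : y = (t *: theta + y *m U) *m U^T.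
    rewrite mulmxDl -mulmxA UU mulmx1 -scalemxAl.
    by rewrite -[theta *m U^T]trmxK trmx_mul trmxK Ut trmx0 scaler0 add0r.
  rewrite mxE (le_trans (ler_norm_sum _ _ _))// /c (bigD1 i)//=.
  rewrite (@le_trans _ _ (\sum_(j < m.+1) M * `|U i j|))//.
    apply: ler_sum => j _; rewrite normrM [U^T _ _]mxE ler_wpM2r//; exact: KM.
  by rewrite lerDl; do 2!apply: sumr_ge0 => ? _; rewrite mulr_ge0// ltW.
by rewrite lebesgue_row_cube// ltry.
Qed.

Lemma section_radius_ge0 t : 0 <= h t.
Proof. exact: powR_ge0. Qed.

Lemma section_radiusX t : (0 < m)%N -> (h t ^+ m)%:E = v t.
Proof.
move=> m0; rewrite /section_radius -powR_mulrn ?powR_ge0// -powRrM mulVf.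
  rewrite powRr1 ?fineK ?section_volume_fin//.
  by apply: fine_ge0; have [U _ ->] := section_frame.
by rewrite pnatr_eq0 -lt0n.
Qed.

(** If [c *: theta] is in the body then, by convexity, the section at height [t]
contains the central section scaled by [1 - t / c]. *)
Lemma section_radius_cone : (0 < m)%N ->
  exists2 c, 0 < c & forall t, 0 < t < c -> (1 - t / c) * h 0 <= h t.
Proof.
move=> m0; have [r r0 rK] := cube_in_body.
pose M := 1 + \sum_(i < m.+1) `|theta ord0 i|.
have M0 : 0 < M by rewrite /M ltr_pwDl// sumr_ge0.
have Kc : K ((r / M) *: theta).
  apply: rK => i; rewrite mxE normrM gtr0_norm ?divr_gt0//.
  rewrite mulrAC ler_pdivrMr// ler_wpM2l ?(ltW r0)// /M (bigD1 i)//=.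
  by rewrite addrCA lerDl addr_ge0// sumr_ge0.
have c0 : 0 < r / M by rewrite divr_gt0.
exists (r / M) => //; move: (r / M) Kc c0 => c Kc c0 t /andP[t0 tc].
pose l := 1 - t / c.
have l0 : 0 < l by rewrite /l subr_gt0 ltr_pdivrMr// mul1r.
have l1 : l <= 1 by rewrite /l lerBlDr lerDl divr_ge0// ltW.
rewrite -/l -(@ler_pXn2r _ m) ?nnegrE ?section_radius_ge0//
    ?mulr_ge0 ?section_radius_ge0 ?(ltW l0)//.
rewrite exprMn -lee_fin EFinM !section_radiusX//.
have [U UH vE] := section_frame; rewrite !vE.
have mK0 : measurable [set y : 'rV[R]_m | K (0 *: theta + y *m U)].
  exact: measurable_slice.
rewrite (lebesgue_row_scale (c := l^-1) _ mK0) ?invr_gt0//.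
rewrite muleA -EFinM -exprMn divff ?gt_eqF// expr1n mul1e.
apply: le_measure; rewrite ?inE.
- apply: measurable_row_preimage (mK0) => i; under eq_fun do rewrite mxE.
  apply: measurable_funM => //; exact: measurable_row_coord.
- exact: measurable_slice.
move=> y /=; rewrite scale0r add0r => Ky.
have -> : t *: theta + y *m U = l *: ((l^-1 *: y) *m U) + (1 - l) *: (c *: theta).
  rewrite -scalemxAl !scalerA divff ?gt_eqF// scale1r addrC; congr (_ + _ *: _).
  by rewrite /l; field; rewrite gt_eqF.
by apply: convex_setP => //; rewrite (ltW l0).
Qed.

Lemma section_radius0_gt0 : (0 < m)%N -> 0 < h 0.
Proof.
move=> m0; rewrite lt0r section_radius_ge0 andbT.
have [r r0 rK] := cube_in_body.
suff : (0 < v 0)%E.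
  rewrite -section_radiusX// lte_fin; apply: contraTneq => ->.
  by rewrite expr0n gtn_eqF// ltxx.
have [U UH ->] := section_frame.
pose c := 1 + \sum_(i < m.+1) \sum_(j < m) `|U j i|.
have c0 : 0 < c by rewrite /c ltr_pwDl// sumr_ge0// => i _; rewrite sumr_ge0.
apply: (@lt_le_trans _ _ (lebesgue_row m
    [set y : 'rV[R]_m | forall i, `|y ord0 i| <= r / c])).
  by rewrite lebesgue_row_cube ?lte_fin ?exprn_gt0 ?addr_gt0 ?divr_gt0 ?divr_ge0// ltW.
apply: le_measure; rewrite ?inE; [exact: measurable_cube|exact: measurable_slice|].
move=> y /= yr; rewrite scale0r add0r; apply: rK => i.
rewrite mxE (le_trans (ler_norm_sum _ _ _))//.
apply: (@le_trans _ _ (\sum_(j < m) r / c * `|U j i|)).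
  by apply: ler_sum => j _; rewrite normrM ler_wpM2r.
rewrite -mulr_sumr mulrAC ler_pdivrMr// ler_wpM2l ?(ltW r0)//.
rewrite /c (bigD1 i)//= addrCA lerDl addr_ge0// sumr_ge0// => k _.
exact: sumr_ge0.
Qed.

Lemma measurable_dotp_theta : measurable_fun setT (fun x : 'rV[R]_m.+1 => dotp x theta).
Proof.
by apply: measurable_dotp => i; [exact: measurable_row_coord|exact: measurable_cst].
Qed.

Lemma measurable_slices (B : set 'rV[R]_m.+1) (U : 'M[R]_(m, m.+1)) :
  measurable B -> measurable_fun [set: measurableTypeR R]
    (fun t => lebesgue_row m [set y | B ((t : R) *: theta + y *m U)]).
Proof.
move=> mB; pose E : set (measurableTypeR R * 'rV[R]_m) :=
  [set p | B ((p.1 : R) *: theta + p.2 *m U)].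
have mE : measurable E.
  apply: measurable_row_preimage => // i; under eq_fun do rewrite mxE.
  apply: measurable_funD; [under eq_fun do rewrite mxE|].
    apply: measurable_funM; last exact: measurable_cst.
    exact: measurable_fst.
  apply: (measurable_mulmx_coord (f := snd)) => j.
  exact: (measurableT_comp (@measurable_row_coord R m j) measurable_snd).
have := measurable_fun_xsection (lebesgue_row m) mE.
congr (measurable_fun _ _); apply/funext => t /=; congr (lebesgue_row m _).
by apply/funext => y; rewrite /xsection /= inE.
Qed.

Lemma integral_indic_scale (C : R) a b : 0 <= C -> a <= b ->
  (\int[mu]_t (C%:E * (\1_(`[a, b]%classic) t)%:E) = (C * (b - a))%:E)%E.
Proof.
move=> C0 ab; rewrite ge0_integralZl_EFin//.
- transitivity (C%:E * mu `[a, b]%classic)%E; first by rewrite integral_indic// setIT.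
  rewrite lebesgue_measure_itv/= lte_fin EFinM; congr (_ * _)%E.
  by case: ltgtP ab => // ->; rewrite subrr.
- by apply/measurable_EFinP; exact: measurable_indic (measurable_itv _).
Qed.

Lemma measurable_indic_scale (C : R) a b :
  measurable_fun setT
    (fun t : measurableTypeR R => (C%:E * (\1_(`[a, b]%classic) t)%:E)%E).
Proof.
apply: emeasurable_funM; first exact: measurable_cst.
by apply/measurable_EFinP; exact: measurable_indic (measurable_itv _).
Qed.

(** The section volume is the density of the marginal along [theta], whose support
beyond [t0] has length at most [hK]. *)
Lemma upper_tail_le t0 C : 0 <= t0 -> 0 <= C ->
  (forall t, t0 <= t <= hK -> (v t <= C%:E)%E) ->
  (lebesgue_row m.+1 (K `&` [set x | (t0 <= dotp x theta)%R]) <= (hK * C)%:E)%E.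
Proof.
move=> t00 C0 vC; have [U UH vE] := section_frame.
have mB : measurable (K `&` [set x | (t0 <= dotp x theta)%R]).
  apply: measurableI => //.
  have := measurable_dotp_theta measurableT (measurable_itv `[t0, +oo[).
  by rewrite setTI set_itvcy.
have hK0 : 0 <= hK.
  have [r r0 rK] := cube_in_body.
  apply: (@le_trans _ _ `|dotp 0 theta|) => //; apply: dotp_le_support.
  by apply: rK => i; rewrite mxE normr0 ltW.
rewrite (lebesgue_row_slices theta1 UH mB).
rewrite mulrC -[X in (C * X)%R]subr0 -integral_indic_scale//.
apply: ge0_le_integral => //.
- exact: measurable_slices.
- exact: measurable_indic_scale.
move=> t _; rewrite indicE.
have [/andP[t0t tK]|tK] := boolP (t0 <= t <= hK).
  rewrite mem_set ?mule1//=; last by rewrite in_itv/= tK (le_trans t00).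
  apply: le_trans (vC t _); last by rewrite t0t.
  rewrite [leRHS]vE; apply: le_measure.
  - by rewrite inE; exact: (measurable_slice U t mB).
  - by rewrite inE; exact: (measurable_slice U t mK).
  - by move=> y [].
rewrite [leLHS](_ : _ = 0%E) ?mule_ge0 ?lee_fin//.
rewrite -(measure0 (lebesgue_row m)); congr (lebesgue_row m _).
apply/seteqP; split => // y /= [Ky]; rewrite dotp_slice// => t0t.
move: tK; rewrite t0t/= => /negP; apply.
have := dotp_le_support Ky; rewrite dotp_slice//; exact: le_trans (ler_norm _).
Qed.

Lemma central_slab_le1 t1 C : 0 <= t1 -> 0 <= C ->
  (forall t, 0 <= t <= t1 -> (C%:E <= v t)%E) -> t1 * C <= 1.
Proof.
move=> t10 C0 Cv; have [U UH vE] := section_frame.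
rewrite -lee_fin -volK (lebesgue_row_slices theta1 UH mK).
rewrite mulrC -[X in (C * X)%R]subr0 -integral_indic_scale//.
apply: ge0_le_integral => //.
- by move=> t _; rewrite mule_ge0// lee_fin.
- exact: measurable_indic_scale.
- exact: measurable_slices.
move=> t _; rewrite indicE.
have [tK|tK] := boolP (t \in _); last by rewrite mule0.
rewrite mule1 -vE; apply: Cv; by move: tK; rewrite inE/= in_itv.
Qed.

End body.

(** * Functions that are concave in the square of their argument *)

Section parabola.
Context {R : realType}.
Implicit Types (h : R -> R) (b c s t k : R).

(** Concavity of [h] as a function of [t ^+ 2], in the form of a tangent line at
[b ^+ 2] that stays above the graph.  The function [h + k * t ^+ 2] has
derivative [t * (- h' b / b - (- h' t / t))], hence increases up to [b] and
decreases after. *)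
Lemma supporting_parabola h hK b :
  (forall t, t \in `]0, hK[ -> derivable h t 1) ->
  {in `]0, hK[ &, {homo (fun t => - h^`()%classic t / t) : s t / s <= t}} ->
  b \in `]0, hK[ ->
  exists k, forall t, t \in `]0, hK[ -> h t <= h b + k * (b ^+ 2 - t ^+ 2).
Proof.
move=> dh mono bK; pose k := - h^`()%classic b / b / 2; exists k => t tK.
have [F FE dF] : exists2 F : R -> R, forall x, F x = h x + k * x ^+ 2 &
    forall x, x \in `]0, hK[ ->
      is_derive x 1 F (h^`()%classic x + k * (2 * x)).
  exists (h + k \*: (id ^+ 2)) => // x xK.
  have := dh _ xK => /derivableP; rewrite -derive1E => dhx.
  by apply: is_derive_eq; congr (_ + _); rewrite /GRing.scale/=; ring.
have sub x y : x \in `]0, hK[ -> y \in `]0, hK[ -> x < y ->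
    exists z, [/\ x < z, z < y, z \in `]0, hK[ &
      F y - F x = (k * 2 * z + h^`()%classic z) * (y - x)].
  rewrite !in_itv/= => /andP[x0 xK] /andP[y0 yK] xy.
  have inK z : z \in `[x, y] -> z \in `]0, hK[.
    rewrite !in_itv/= => /andP[xz zy].
    by rewrite (lt_le_trans x0)//= (le_lt_trans zy).
  have dFxy z : z \in `]x, y[ -> is_derive z 1 F (h^`()%classic z + k * (2 * z)).
    by move=> zxy; apply: dF; apply: inK; exact: subset_itv_oo_cc zxy.
  have cF : {within `[x, y], continuous F}.
    by apply: derivable_within_continuous => z zxy; have [] := dF _ (inK _ zxy).
  have [z zxy zE] := MVT xy dFxy cF.
  exists z; split; [by rewrite (itvP zxy)|by rewrite (itvP zxy)| |].
    by apply: inK; exact: subset_itv_oo_cc zxy.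
  by rewrite zE; congr (_ * _); ring.
have pos z : z \in `]0, hK[ -> k * 2 * z + h^`()%classic z =
    z * (- h^`()%classic b / b - - h^`()%classic z / z).
  rewrite in_itv/= => /andP[z0 _]; rewrite /k; field.
  by rewrite gt_eqF//=; move: bK; rewrite in_itv/= => /andP[b0 _]; rewrite gt_eqF.
suff : F t <= F b by rewrite !FE; lra.
have z0 z : z \in `]0, hK[ -> 0 <= z by rewrite in_itv/= => /andP[/ltW].
have [tb|bt|->//] := ltgtP t b.
  have [z [tz zb zK e]] := sub _ _ tK bK tb.
  rewrite -subr_ge0 e pos// mulr_ge0 ?subr_ge0 ?(ltW tb)//.
  by apply: mulr_ge0; [exact: z0|rewrite subr_ge0]; apply: mono => //; exact: ltW.
have [z [bz zt zK e]] := sub _ _ bK tK bt.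
rewrite -subr_le0 e pos// mulr_le0_ge0 ?subr_ge0 ?(ltW bt)//.
by apply: mulr_ge0_le0; [exact: z0|rewrite subr_le0]; apply: mono => //; exact: ltW.
Qed.

(** The supporting parabola extends to [0] because [h] is lower semicontinuous
there, which the linear lower bound expresses. *)
Lemma parabola_at0 h hK b c k : 0 < hK -> 0 < c ->
  (forall t, 0 < t < c -> (1 - t / c) * h 0 <= h t) ->
  (forall t, t \in `]0, hK[ -> h t <= h b + k * (b ^+ 2 - t ^+ 2)) ->
  h 0 <= h b + k * b ^+ 2.
Proof.
move=> hK0 c0 lb ub; apply/ler_addgt0Pr => e e0.
(* [D] bounds the slope at which both sides move when [t] leaves [0]. *)
pose D := `|h 0| / c + `|k| + 1.
have D0 : 0 < D by rewrite /D ltr_wpDl// addr_ge0// divr_ge0// ltW.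
pose t := Num.min (Num.min 1 (c / 2)) (Num.min (hK / 2) (e / D)).
have eD : 0 < e / D by rewrite divr_gt0.
have t0 : 0 < t by rewrite /t !lt_min ltr01 eD !divr_gt0.
have : t <= t by []. rewrite {2}/t !le_min -!andbA => /and4P[t1 tc tK te].
have {}lb : (1 - t / c) * h 0 <= h t by apply: lb; rewrite t0/=; lra.
have {}ub : h t <= h b + k * (b ^+ 2 - t ^+ 2).
  by apply: ub; rewrite in_itv/= t0/=; lra.
have : t * D <= e by rewrite -ler_pdivlMr.
have h1 : t / c * h 0 <= t * (`|h 0| / c).
  rewrite mulrAC -mulrA ler_wpM2l ?(ltW t0)// ler_pM2r ?invr_gt0//; exact: ler_norm.
have h2 : - k * t ^+ 2 <= t * `|k|.
  apply: (@le_trans _ _ (`|k| * t ^+ 2)).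
    by rewrite ler_wpM2r ?sqr_ge0// -normrN ler_norm.
  by rewrite mulrC ler_wpM2r// expr2 ger_pMl.
rewrite /D !mulrDr => h3; lra.
Qed.

Section concave_in_square.
Variables (h : R -> R) (hK c t0 : R).
Hypothesis dh : forall t, t \in `]0, hK[ -> derivable h t 1.
Hypothesis mono : {in `]0, hK[ &,
    {homo (fun t => - h^`()%classic t / t) : s t / s <= t}}.
Hypothesis c0 : 0 < c.
Hypothesis lb : forall t, 0 < t < c -> (1 - t / c) * h 0 <= h t.
Hypothesis t0K : 0 < t0 < hK.

Lemma square_chord_le s : t0 <= s < hK ->
  h s <= h 0 - (h 0 - h t0) * (s / t0) ^+ 2.
Proof.
move=> /andP[t0s sK]; have /andP[t00 tK] := t0K.
have [|k kP] := supporting_parabola dh mono (b := t0); first by rewrite in_itv/= t00.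
have := parabola_at0 (lt_trans t00 tK) c0 lb kP => k0.
have := kP s; rewrite in_itv/= (lt_le_trans t00 t0s) sK => /(_ isT) hs.
rewrite (le_trans hs)// -subr_ge0.
have -> : h 0 - (h 0 - h t0) * (s / t0) ^+ 2 - (h t0 + k * (t0 ^+ 2 - s ^+ 2)) =
  (h t0 + k * t0 ^+ 2 - h 0) * ((s / t0) ^+ 2 - 1) by field; rewrite gt_eqF.
rewrite mulr_ge0// ?subr_ge0// -(expr1n _ 2) ler_pXn2r ?nnegrE ?divr_ge0//.
- by rewrite ler_pdivlMr// mul1r.
- by rewrite (le_trans (ltW t00)).

- exact: ltW.
Qed.

(** Average the supporting parabola at [t], evaluated at [0] and at [t0], with
weights [1 - (t / t0) ^+ 2] and [(t / t0) ^+ 2]. *)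
Lemma square_chord_ge t : 0 < t <= t0 ->
  h 0 - (h 0 - h t0) * (t / t0) ^+ 2 <= h t.
Proof.
move=> /andP[tpos tt0]; have /andP[t00 tK] := t0K.
have [|k kP] := supporting_parabola dh mono (b := t).
  by rewrite in_itv/= tpos (le_lt_trans tt0).
have := parabola_at0 (lt_trans t00 tK) c0 lb kP => k0.
have := kP t0; rewrite in_itv/= t00 tK => /(_ isT) hs.
pose u := (t / t0) ^+ 2.
have u0 : 0 <= u by exact: sqr_ge0.
have u1 : u <= 1.
  rewrite /u -(expr1n _ 2) ler_pXn2r ?nnegrE ?divr_ge0//; [|exact: ltW|exact: ltW].
  by rewrite ler_pdivrMr// mul1r.
rewrite -/u -subr_ge0.
have -> : h t - (h 0 - (h 0 - h t0) * u) =
  (h t + k * t ^+ 2 - h 0) * (1 - u) + (h t + k * (t ^+ 2 - t0 ^+ 2) - h t0) * u.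
  by rewrite /u; field; rewrite gt_eqF.
by rewrite addr_ge0// mulr_ge0// subr_ge0.
Qed.

End concave_in_square.
End parabola.

(** * Numerical estimates *)

Section numeric.
Context {R : realType}.

Lemma ln_nat_ge_half (N : nat) : (1 < N)%N -> 2^-1 <= ln N%:R :> R.
Proof.
move=> N1; have N0 : 0 < N%:R :> R by rewrite ltr0n (ltn_trans _ N1).
have h : -1 < N%:R^-1 - 1 :> R by rewrite ltrBrDr addNr invr_gt0.
have := le_ln1Dx h; rewrite addrC subrK lnV ?posrE//.
have : N%:R^-1 <= 2^-1 :> R by rewrite lef_pV2 ?posrE// ler_nat.
lra.
Qed.

Lemma bernoulli_inequality (x : R) n : 0 <= x <= 1 -> 1 - n%:R * x <= (1 - x) ^+ n.
Proof.
move=> /andP[x0 x1]; elim: n => [|n IH]; first by rewrite expr0 mul0r subr0.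
rewrite exprS -natr1; apply: (@le_trans _ _ ((1 - x) * (1 - n%:R * x))); last first.
  by rewrite ler_wpM2l// subr_ge0.
have : 0 <= n%:R * x ^+ 2 by rewrite mulr_ge0// sqr_ge0.
lra.
Qed.

(** By [1 - x <= exp (- x)], the left-hand side is at most
[N ^ (- 8 * m / m.+1)], and [m / m.+1] is at least one half. *)
Lemma exprn_1B_ln_le (m N : nat) : (0 < m)%N -> (1 < N)%N ->
  let delta := 8 * (ln N%:R / m.+1%:R) : R in delta <= 1 ->
  (1 - delta) ^+ m <= N%:R ^- 4.
Proof.
move=> m0 N1 delta d1.
have N0 : 0 < N%:R :> R by rewrite ltr0n (ltn_trans _ N1).
have lN : 0 < ln N%:R :> R by apply: lt_le_trans (ln_nat_ge_half N1); lra.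
apply: (@le_trans _ _ (expR (- delta) ^+ m)).
  by rewrite lerXn2r ?nnegrE ?expR_ge0 ?subr_ge0// (le_trans _ (expR_ge1Dx _)).
have -> : N%:R ^- 4 = expR (- (4 * ln N%:R)) :> R by rewrite expRN expRM_natl lnK.
rewrite -expRM_natl ler_expR /delta mulrN lerN2 mulrCA.
have -> : m%:R * (ln N%:R / m.+1%:R) = (m%:R / m.+1%:R) * ln N%:R :> R by ring.
rewrite mulrA ler_pM2r//.
suff : 2^-1 <= m%:R / m.+1%:R :> R by move: (m%:R / _) => q; lra.
rewrite ler_pdivlMr ?ltr0n// -[m.+1%:R]natr1.
have : 1 <= m%:R :> R by rewrite ler1n.
lra.
Qed.

(** With [n = m.+1], the assumptions give [hK ^+ 2 <= t0 ^+ 2 * n / 4] and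
[H <= 2 * n / t0], so that the second summand is at most
[t0 * n ^+ 2 * N ^- 3 <= t0]. *)
Lemma moment_bound (m N : nat) (delta t0 hK H p : R) : (0 < m)%N -> (m < N)%N ->
  delta = 8 * (ln N%:R / m.+1%:R) -> 0 < t0 -> 0 <= hK -> 0 <= H ->
  delta * hK ^+ 2 <= t0 ^+ 2 ->
  (t0 / m.+1%:R) * (H / 2) <= 1 ->
  p <= hK * (H * N%:R ^- 4) ->
  t0 + hK * (N%:R * (p + p)) <= 2 * t0.
Proof.
move=> m0 mN dE t00 hK0 H0 hKle volle pl.
pose n : R := m.+1%:R.
have n0 : 0 < n by rewrite /n ltr0n.
have N1 : (1 < N)%N by rewrite (leq_ltn_trans m0).
have nN : n <= N%:R by rewrite /n ler_nat.
have N0 : 0 < N%:R :> R by rewrite (lt_le_trans n0).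
have lN := ln_nat_ge_half N1.
have hK2 : hK ^+ 2 <= t0 ^+ 2 * n / 4.
  have d4 : 4 / n <= delta.
    by rewrite dE mulrA ler_wpM2r ?invr_ge0 ?(ltW n0)//; lra.
  have -> : hK ^+ 2 = n / 4 * (4 / n * hK ^+ 2) by field; rewrite gt_eqF.
  rewrite [leRHS](_ : _ = n / 4 * t0 ^+ 2); last by ring.
  rewrite ler_wpM2l ?divr_ge0 ?(ltW n0)//.
  by apply: le_trans hKle; rewrite ler_wpM2r ?sqr_ge0.
have HK2 : H <= 2 * n / t0.
  rewrite ler_pdivlMr// mulrC.
  move: volle; rewrite -/n mulrACA -invfM ler_pdivrMr ?mulr_gt0//; lra.
rewrite mulr2n mulrDl mul1r lerD2l.
apply: (@le_trans _ _ (2 * hK ^+ 2 * H * (N%:R * N%:R ^- 4))).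
  have -> : 2 * hK ^+ 2 * H * (N%:R * N%:R ^- 4) =
    hK * (N%:R * (hK * (H * N%:R ^- 4) + hK * (H * N%:R ^- 4))) by ring.
  by rewrite ler_wpM2l// ler_wpM2l ?(ltW N0)// lerD.
apply: (@le_trans _ _ (2 * (t0 ^+ 2 * n / 4) * (2 * n / t0) * (N%:R * N%:R ^- 4))).
  rewrite ler_wpM2r ?mulr_ge0 ?invr_ge0 ?exprn_ge0 ?(ltW N0)//.
  by rewrite ler_pM ?mulr_ge0 ?sqr_ge0// ler_wpM2l.
have -> : 2 * (t0 ^+ 2 * n / 4) * (2 * n / t0) * (N%:R * N%:R ^- 4) =
    t0 * (n / N%:R) ^+ 2 * N%:R^-1 by field; rewrite !gt_eqF.
rewrite -mulrA ger_pMr// mulr_ile1 ?sqr_ge0 ?invr_ge0 ?(ltW N0)//.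
  by rewrite expr_le1 ?divr_ge0 ?(ltW n0) ?(ltW N0)// ler_pdivrMr// mul1r.
by rewrite invf_le1// ler1n ltnW.
Qed.

End numeric.

(** Passage to the limit [s --> b] in [d * s ^+ 2 <= t0 ^+ 2]. *)
Lemma sqr_le_at_endpoint (R : realFieldType) (d t0 b : R) :
  0 <= d -> 0 < t0 < b -> (forall s, t0 <= s < b -> d * s ^+ 2 <= t0 ^+ 2) ->
  d * b ^+ 2 <= t0 ^+ 2.
Proof.
move=> d0 /andP[t00 t0b] H; apply/ler_addgt0Pr => e e0.
have b0 : 0 < b by exact: lt_trans t0b.
pose D := 2 * d * b + 1.
have D0 : 0 < D by rewrite /D ltr_wpDl// !mulr_ge0// ltW.
pose eps := Num.min (b - t0) (e / D).
have eps0 : 0 < eps by rewrite /eps lt_min subr_gt0 t0b divr_gt0.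
have : eps <= eps by []. rewrite {2}/eps le_min => /andP[e1 e2].
have {}H : d * (b - eps) ^+ 2 <= t0 ^+ 2 by apply: H; apply/andP; split; lra.
have : eps * D <= e by rewrite -ler_pdivlMr.
have : 0 <= d * eps ^+ 2 by rewrite mulr_ge0// sqr_ge0.
rewrite /D; nra.
Qed.

(** * Expectation of a maximum and uniform vectors *)

Section expectation_max.
Context {R : realType}.

Lemma measurable_bigmax0 d (T : measurableType d) N (f : 'I_N -> T -> R) :
  (forall i, measurable_fun setT (f i)) ->
  measurable_fun setT (fun w => \big[Num.max/0]_(i < N) f i w).
Proof.
elim: N f => [|N IH] f mf.
  by under eq_fun do rewrite big_ord0; exact: measurable_cst.
under eq_fun do rewrite big_ord_recl.
by apply: measurable_maxr => //; exact: IH.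
Qed.

Lemma measurable_norm_ge d (T : measurableType d) (f : T -> R) (a : R) :
  measurable_fun setT f -> measurable [set w | a <= `|f w|].
Proof.
move=> mf.
have := measurableT_comp (@normr_measurable R setT) mf.
move=> /(_ measurableT `[a, +oo[%classic (measurable_itv _)).
by rewrite setTI set_itvcy.
Qed.

(** A union bound: the maximum exceeds [a] by at most [b] for every index [i] with
[`|Y i|] at least [a]. *)
Lemma expectation_bigmax_le d (T : measurableType d) (P : probability T R) N
    (Y : 'I_N -> T -> R) (a b p : R) :
  0 <= a -> 0 <= b -> (forall i, measurable_fun setT (Y i)) ->
  (forall i, {ae P, forall w,
    `|Y i w| <= a + b * \1_[set w | a <= `|Y i w|] w}) ->
  (forall i, (P [set w | (a <= `|Y i w|)%R] <= p%:E)%E) ->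
  ('E_P[fun w => \big[Num.max/0%R]_(i < N) `|Y i w|%R] <=
    (a + b * (N%:R * p))%:E)%E.
Proof.
move=> a0 b0 mY aeY Pp.
have mA i := measurable_norm_ge a (mY i).
have mI i : measurable_fun setT (fun w => (b%:E * (\1_[set w | a <= `|Y i w|] w)%:E)%E).
  apply: emeasurable_funM; first exact: measurable_cst.
  by apply/measurable_EFinP; exact: measurable_indic.
rewrite unlock.
apply: (@le_trans _ _ (\int[P]_w (a%:E + \sum_(i < N)
    (b%:E * (\1_[set w | (a <= `|Y i w|)%R] w)%:E))%E)%E).
  apply: ae_ge0_le_integral => //.
  - move=> w _; rewrite lee_fin; apply: bigmax_ge_id.
  - apply/measurable_EFinP; apply: measurable_bigmax0 => i.
    exact: measurableT_comp.
  - move=> w _; rewrite adde_ge0// sume_ge0// => i _.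
    by rewrite mule_ge0// lee_fin.
  - apply: emeasurable_funD; first exact: measurable_cst.
    exact: emeasurable_sum.
  have : \forall w \ae P, forall i, `|Y i w| <= a + b * \1_[set w | a <= `|Y i w|] w.
    by apply: filter_forall => i; exact: aeY.
  apply: filterS => w H _.
  rewrite (eq_bigr (fun i => (b * \1_[set w | a <= `|Y i w|] w)%:E)) => [|i _]; last first.
    by rewrite EFinM.
  rewrite sumEFin -EFinD lee_fin.
  have s0 i : 0 <= b * \1_[set w | a <= `|Y i w|] w by rewrite mulr_ge0.
  apply: bigmax_le => [|i _]; first by rewrite addr_ge0// sumr_ge0.
  rewrite (le_trans (H i))// lerD2l (bigD1 i)//= lerDl sumr_ge0//.
rewrite ge0_integralD//; last 2 first.
- by move=> w _; rewrite sume_ge0// => i _; rewrite mule_ge0// lee_fin.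
- exact: emeasurable_sum.
rewrite integral_cst// [X in (_ * X)%E]probability_setT mule1 EFinD leeD2l//.
rewrite ge0_integral_sum//; last first.
  by move=> i w _; rewrite mule_ge0// lee_fin.
apply: (@le_trans _ _ (\sum_(i < N) (b * p)%:E)%E).
  apply: lee_sum => i _; rewrite ge0_integralZl//; last first.
    by apply/measurable_EFinP; exact: measurable_indic.
  rewrite integral_indic// setIT EFinM lee_wpmul2l ?lee_fin//.
  exact: Pp.
by rewrite sumEFin lee_fin sumr_const card_ord mulr_natl mulrnAr.
Qed.

End expectation_max.

Section uniform.
Context {R : realType} (n : nat) d (Omega : measurableType d)
  (P : probability Omega R).
Variables (K : set 'rV[R]_n.+1) (theta : 'rV[R]_n.+1).
Variable (X : {RV P >-> 'rV[R]_n.+1}).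
Hypothesis cptK : compact K.
Hypothesis symK : symmetric_set K.
Hypothesis volK : lebesgue_row n.+1 K = 1%E.
Hypothesis uX : uniform_in P K X.

Lemma uniform_inE A : measurable A -> P (X @^-1` A) = lebesgue_row n.+1 (K `&` A).
Proof. by move=> mA; rewrite uX// volK invr1 mule1. Qed.

Lemma uniform_ae_in : {ae P, forall w, K (X w)}.
Proof.
have mK := compact_measurable_row cptK.
exists (X @^-1` (~` K)); split => //.
  by rewrite -[X in measurable X]setTI; apply: measurable_funPT => //; exact: measurableC.
by rewrite uniform_inE ?setICr ?measure0//; exact: measurableC.
Qed.

(** The two half-spaces [t <= <x, theta>] and [t <= - <x, theta>] cut off mirror
images of the same volume. *)
Lemma uniform_tail_le t p :
  (lebesgue_row n.+1 (K `&` [set x | (t <= dotp x theta)%R]) <= p%:E)%E ->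
  (P [set w | (t <= `|dotp (X w) theta|)%R] <= (p + p)%:E)%E.
Proof.
move=> tp; have mK := compact_measurable_row cptK.
have mdot := measurable_dotp_theta theta.
have mge : measurable [set x : 'rV[R]_n.+1 | t <= dotp x theta].
  have := mdot measurableT `[t, +oo[%classic (measurable_itv _).
  by rewrite setTI set_itvcy.
have mle : measurable [set x : 'rV[R]_n.+1 | t <= - dotp x theta].
  have := (measurableT_comp (@oppr_measurable R setT) mdot)
    measurableT `[t, +oo[%classic (measurable_itv _).
  by rewrite setTI set_itvcy.
have -> : [set w | t <= `|dotp (X w) theta|] =
    X @^-1` ([set x | t <= dotp x theta] `|` [set x | t <= - dotp x theta]).
  apply/seteqP; split => w /=; rewrite ler_normr => /orP; by [].
rewrite uniform_inE; last exact: measurableU.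
rewrite setIUr EFinD; apply: le_trans (measureU2 _ _ _) _; try exact: measurableI.
have E : lebesgue_row n.+1 (K `&` [set x | t <= - dotp x theta]) =
    lebesgue_row n.+1 (K `&` [set x | t <= dotp x theta]).
  rewrite -[RHS]lebesgue_row_opp//; last exact: measurableI.
  congr (lebesgue_row _ _); apply/seteqP; split => x /= [Kx].
    by split; [exact: symK|rewrite !dotpE mulNmx mxE -dotpE].
  rewrite !dotpE mulNmx mxE; split=> //; rewrite -[x]opprK; exact: symK.
by apply: leeD; [exact: tp|move: tp; rewrite -E; exact].
Qed.

End uniform.

(** * The tail of the marginal *)

Section main.
Context {R : realType} (m : nat).
Variables (K : set 'rV[R]_m.+1) (theta : 'rV[R]_m.+1).
Hypothesis m0 : (0 < m)%N.
Hypothesis cptK : compact K.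
Hypothesis cvxK : convex_set K.
Hypothesis intK : K° !=set0.
Hypothesis symK : symmetric_set K.
Hypothesis volK : lebesgue_row m.+1 K = 1%E.
Hypothesis theta1 : dotp theta theta = 1.
Local Notation h := (section_radius K theta).
Local Notation hK := (support_function K theta).
Hypothesis dh : forall t, t \in `]0, hK[ -> derivable h t 1.
Hypothesis mono : {in `]0, hK[ &,
    {homo (fun t => - h^`()%classic t / t) : s t / s <= t}}.
Hypothesis hhK : h hK = 0.

(** The real number [p] bounds the volume of the cap beyond [t0]; the second
conjunct is what the union bound over [N] vectors and two caps requires. *)
Lemma tail_moment_le (N : nat) (t0 : R) :
  let delta := 8 * (ln N%:R / m.+1%:R) in
  (m < N)%N -> 0 < t0 < hK -> h t0 = h 0 * (1 - delta) ->
  exists p, (lebesgue_row m.+1 (K `&` [set x | (t0 <= dotp x theta)%R]) <= p%:E)%E /\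
    t0 + hK * (N%:R * (p + p)) <= 2 * t0.
Proof.
move=> delta mN t0K ht0; have /andP[t00 t0hK] := t0K.
have N1 : (1 < N)%N by rewrite (leq_ltn_trans m0).
have h00 := section_radius0_gt0 cptK cvxK intK symK theta1 m0.
have [c c0 cone] := section_radius_cone cptK cvxK intK symK theta1 m0.
have d0 : 0 < delta.
  have lN : 0 < ln N%:R :> R.
    by apply: (@lt_le_trans _ _ 2^-1); [rewrite invr_gt0|exact: ln_nat_ge_half].
  by rewrite /delta mulr_gt0// divr_gt0.
have d1 : delta <= 1.
  have := section_radius_ge0 K theta t0; rewrite ht0 pmulr_rge0// subr_ge0//.
have up := square_chord_le dh mono c0 cone t0K.
have lo := square_chord_ge dh mono c0 cone t0K.
have hd : h 0 - h t0 = h 0 * delta by rewrite ht0; ring.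
rewrite hd in up lo.
have hK0 : 0 <= hK by rewrite ltW// (lt_trans t00).
have sq : delta * hK ^+ 2 <= t0 ^+ 2.
  apply: sqr_le_at_endpoint => //; first exact: ltW.
  move=> s /up; move=> hs; have := le_trans (section_radius_ge0 K theta s) hs.
  rewrite -mulrA -[X in X - _]mulr1 -mulrBr pmulr_rge0// subr_ge0 expr_div_n mulrA.
  by rewrite ler_pdivrMr ?exprn_gt0// mul1r.
pose H := h 0 ^+ m.
have H0 : 0 <= H by rewrite exprn_ge0// ltW.
(* For [t <= t0 / m.+1], concavity in [t ^+ 2] together with [delta <= 1] gives
   [h t >= h 0 * (1 - m.+1 ^- 2)], and the [m]-th power of the last factor is at
   least one half. *)
have low : (t0 / m.+1%:R) * (H / 2) <= 1.
  apply: (central_slab_le1 cptK volK theta1).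
  - by rewrite divr_ge0// ltW.
  - by rewrite divr_ge0.
  move=> t /andP[t_ge0 tt]; rewrite -section_radiusX// lee_fin.
  have := t_ge0; rewrite le_eqVlt => /predU1P[<-|tpos]; first by rewrite -/H; lra.
  have tt0 : t <= t0.
    by rewrite (le_trans tt)// ler_pdivrMr ?ltr0n// ler_peMr ?(ltW t00)// ler1n.
  have := lo t; rewrite tpos tt0 => /(_ isT) ht.
  pose x : R := m.+1%:R ^- 2.
  have x01 : 0 <= x <= 1.
    by rewrite /x invr_ge0 exprn_ge0//= invf_le1 ?exprn_gt0// exprn_ege1// ler1n.
  have tx : (t / t0) ^+ 2 <= x.
    rewrite /x -exprVn ler_pXn2r// ?nnegrE ?divr_ge0 ?invr_ge0 ?(ltW t00)//.
    by rewrite ler_pdivrMr// mulrC.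
  have hx : h 0 * (1 - x) <= h t.
    apply: le_trans ht; rewrite mulrBr mulr1 lerD2l lerN2 -mulrA ler_pM2l//.
    by apply: le_trans tx; rewrite ger_pMl// ?exprn_gt0 ?divr_gt0.
  apply: (@le_trans _ _ ((h 0 * (1 - x)) ^+ m)); last first.
    rewrite lerXn2r ?nnegrE ?section_radius_ge0// mulr_ge0 ?(ltW h00)// subr_ge0.
    by have /andP[] := x01.
  rewrite exprMn ler_wpM2l// (le_trans _ (bernoulli_inequality m x01))//.
  suff : m%:R * x <= 2^-1 by lra.
  rewrite /x ler_pdivrMr ?exprn_gt0// -[m.+1%:R]natr1.
  have : 0 <= m%:R ^+ 2 :> R by exact: sqr_ge0.
  nra.
exists (hK * (H * N%:R ^- 4)); split; last first.
  exact: (moment_bound m0 mN (erefl delta) t00 hK0 H0 sq low (lexx _)).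
apply: upper_tail_le => //; first exact: ltW.
  by rewrite mulr_ge0// invr_ge0 exprn_ge0.
move=> t /andP[t0t]; rewrite le_eqVlt -section_radiusX// lee_fin => /predU1P[->|tK].
  by rewrite hhK expr0n gtn_eqF// mulr_ge0// invr_ge0 exprn_ge0.
apply: (@le_trans _ _ ((h 0 * (1 - delta)) ^+ m)); last first.
  by rewrite exprMn ler_wpM2l//; exact: exprn_1B_ln_le.
rewrite lerXn2r ?nnegrE ?section_radius_ge0// ?mulr_ge0 ?(ltW h00) ?subr_ge0//.
have := up t; rewrite t0t tK => /(_ isT) /le_trans; apply.
rewrite mulrBr mulr1 lerD2l lerN2; apply: ler_peMr.
  by apply: mulr_ge0; exact: ltW.
by rewrite exprn_ege1// ler_pdivlMr// mul1r.
Qed.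

End main.

Theorem theorem4p1 (R : realType) :
  exists alpha C : R, [/\ 0 < alpha, 0 < C, C < alpha &
    forall (n N : nat) (K : set 'rV[R]_n) (theta : 'rV[R]_n)
      (d : measure_display) (Omega : measurableType d) (P : probability Omega R)
      (X : 'I_N -> {RV P >-> 'rV[R]_n}),
    let h := section_radius K theta in
    let hK := support_function K theta in
    (0 < n)%N -> (n <= N)%N ->
    convex_body K -> symmetric_set K -> isotropic K ->
    dotp theta theta = 1 ->
    (forall i, uniform_in P K (X i)) ->
    independent_vectors P (fun i => X i : Omega -> 'rV[R]_n) ->
    (forall t, t \in `]0, hK[ -> derivable h t 1 /\ derivable h^`()%classic t 1) ->
    (forall t, t \in `]0, hK[ -> h^`()%classic t != 0) ->
    {in `]0, hK[ &, {homo (fun t => - h^`()%classic t / t) : s t / s <= t}} ->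
    h hK = 0 ->
    ('E_P[fun w => \big[Num.max/0%R]_(i < N) `|dotp (X i w) theta|%R]
      <= (C * inverse_on hK h (h 0 * (1 - alpha * (ln N%:R / n%:R))))%:E)%E].
Proof.
exists 8, 2; split => //; first by rewrite ltr_nat.
move=> n N K theta d Omega P X h hK n0 nN [cptK cvxK intK] symK [volK _ _] theta1
  unifX _ dh _ mono hhK.
have [m nE] : exists m, n = m.+1 by exists n.-1; rewrite prednK.
subst n.
(* In dimension one the section radius is constantly [1], against [h hK = 0]. *)
have [mz|m0] := posnP m.
  exfalso; move: hhK; have m00 : m%:R = 0 :> R by rewrite mz.
  by rewrite /h /section_radius /= m00 invr0 powRr0 => /eqP; rewrite oner_eq0.
set y := h 0 * _; pose t0 := inverse_on hK h y.
have mY i : measurable_fun setT (fun w => dotp (X i w) theta).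
  exact: (measurableT_comp (measurable_dotp_theta theta)).
have XK i : {ae P, forall w, `|dotp (X i w) theta| <= hK}.
  apply: filterS (uniform_ae_in cptK volK (unifX i)) => w.
  exact: dotp_le_support.
have hK0 : 0 <= hK.
  have [r r0 rK] := cube_in_body cvxK intK symK.
  apply: (@le_trans _ _ `|dotp 0 theta|) => //; apply: dotp_le_support => //.
  by apply: rK => i; rewrite mxE normr0 ltW.
(* The maximum is almost surely at most [hK]: the union bound with [a = hK] and
   [b = 0]. *)
have trivial_case : t0 = hK ->
  ('E_P[fun w => \big[Num.max/0%R]_(i < N) `|dotp (X i w) theta|%R]
      <= (2 * t0)%:E)%E.
  move=> ->.
  have := @expectation_bigmax_le _ _ _ P N (fun i w => dotp (X i w) theta) hK 0 1.
  rewrite mul0r addr0 => /(_ hK0 (lexx _) mY) H; apply: le_trans (H _ _) _.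
  - by move=> i; apply: filterS (XK i) => w; rewrite mul0r addr0.
  - by move=> i; apply: probability_le1; exact: measurable_norm_ge.
  - by rewrite lee_fin; lra.
have [yin|yout] := pselect (exists2 t, 0 <= t <= hK & h t = y); last first.
  by apply: trivial_case; exact: inverse_on_out.
have [/andP[]] := inverse_onK yin; rewrite -/t0 => t0_ge0 t0_le ht0.
have [/trivial_case//|t0_neq] := eqVneq t0 hK.
have t0_lt : t0 < hK by rewrite lt_neqAle t0_neq.
have N1 : (1 < N)%N by rewrite (leq_trans _ nN)// ltnS m0.
have lN : 0 < ln N%:R :> R.
  by apply: (@lt_le_trans _ _ 2^-1); [rewrite invr_gt0|exact: ln_nat_ge_half].
have t0_gt0 : 0 < t0.
  rewrite lt0r t0_ge0 andbT; apply/eqP => t00; move: ht0; rewrite t00 /y.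
  have h00 := section_radius0_gt0 cptK cvxK intK symK theta1 m0.
  have : 0 < h 0 * (8 * (ln N%:R / m.+1%:R)).
    by rewrite mulr_gt0// mulr_gt0// divr_gt0.
  by rewrite mulrBr mulr1; move: (h 0 * _) => q; lra.
have [p [pP pE]] := tail_moment_le m0 cptK cvxK intK symK volK theta1
  (fun t tK => (dh t tK).1) mono hhK nN (introT andP (conj t0_gt0 t0_lt)) ht0.
have := @expectation_bigmax_le _ _ _ P N (fun i w => dotp (X i w) theta) t0 hK (p + p).
move=> /(_ t0_ge0 hK0 mY) H; apply: le_trans (H _ _) _; last by rewrite lee_fin.
  move=> i; apply: filterS (XK i) => w wK; rewrite indicE.
  have [w0|w0] := boolP (w \in _); first by rewrite mulr1 (le_trans wK)// lerDr.
  rewrite mulr0 addr0 leNgt; apply: contra w0 => /ltW tw; exact: mem_set.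
by move=> i; exact: (uniform_tail_le cptK symK volK (unifX i) pP).
Qed.
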